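(* Let $K$ be an infinite field and let $P$ be a partition of a positive integer $n$. Then $P$ is stable (that is, $Q(P)=P$) if and only if the parts of $P$ differ pairwise by at least two.
   Context: A partition $P=(p_1,\ldots,p_t)$ of $n$ is a sequence of integers $p_1\ge\cdots\ge p_t\ge 1$ with sum $n$. $J_P$ denotes the $n\times n$ nilpotent matrix in Jordan form with block sizes the parts of $P$. For an $n\times n$ nilpotent matrix $B$ over $K$, $\mathcal N_B$ denotes the set of nilpotent $n\times n$ matrices over $K$ commuting with $B$; it is an irreducible algebraic variety. For $B=J_P$, $Q(P)$ denotes the partition of $n$ given by the Jordan block sizes of a generic element of $\mathcal N_B$, i.e. of every element of some dense Zariski-open subset of $\mathcal N_B$. The partition $P$ is called stable if $Q(P)=P$. ''The parts differ pairwise by at least two'' means $p_u-p_{u+1}\ge 2$ for $1\le u\le t-1$. *)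

(* Defs.v *)
From mathcomp Require Import all_boot all_order all_algebra.
From mathcomp Require Import mpoly.

Set Implicit Arguments.
Unset Strict Implicit.
Unset Printing Implicit Defensive.

Import GRing.Theory.
Local Open Scope ring_scope.

Definition infinite_field (K : fieldType) : Prop :=
  forall s : seq K, exists x : K, x \notin s.

Definition is_partition (n : nat) (P : seq nat) : bool :=
  [&& sorted geq P, all (fun p => 1 <= p)%N P & sumn P == n].

(* [reshape_index P i] is the block of [P] that contains the index [i]: the
   ones lie on the superdiagonal, inside each diagonal block. *)
Definition jordan_mx (K : fieldType) (n : nat) (P : seq nat) : 'M[K]_n :=
  \matrix_(i, j) ((j == i.+1 :> nat)
                  && (reshape_index P i == reshape_index P j))%:R.

Definition jordan_type (K : fieldType) (n : nat) (A : 'M[K]_n) (R : seq nat) :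
    Prop :=
  is_partition n R /\ similar_in unitmx A (jordan_mx K n R).

Definition nilpotent_mx (K : fieldType) (n : nat) (A : 'M[K]_n) : Prop :=
  exists k : nat, A ^+ k = 0.

Definition nilpotent_commutator (K : fieldType) (n : nat) (B : 'M[K]_n) :
    'M[K]_n -> Prop :=
  fun A => nilpotent_mx A /\ comm_mx A B.

(* The Zariski topology on the space of n x n matrices over K (as K-points of
   affine n^2-space), relativized to a set [V]: an open subset of [V] is the
   complement in [V] of the common zeros of a set [S] of polynomials in the
   matrix entries. *)
Definition zariski_open_in (K : fieldType) (n : nat) (V U : 'M[K]_n -> Prop) :
    Prop :=
  exists S : {mpoly K[n * n]} -> Prop, forall A : 'M[K]_n,
    U A <-> V A /\ exists2 p, S p & p.@[mxvec A 0] != 0.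

Definition zariski_dense_in (K : fieldType) (n : nat) (V U : 'M[K]_n -> Prop) :
    Prop :=
  forall W : 'M[K]_n -> Prop, zariski_open_in V W ->
    (exists A, W A) -> exists A, W A /\ U A.

(* The graph of Q: [is_Q K n P R] means Q(P) = R. At most one R qualifies: two
   dense open subsets of the nonempty set N_{J_P} meet, and the Jordan type of a
   matrix is unique. *)
Definition is_Q (K : fieldType) (n : nat) (P R : seq nat) : Prop :=
  exists U : 'M[K]_n -> Prop,
    [/\ zariski_open_in (nilpotent_commutator (jordan_mx K n P)) U,
        zariski_dense_in (nilpotent_commutator (jordan_mx K n P)) U
      & forall A, U A -> jordan_type A R].

Definition stable (K : fieldType) (n : nat) (P : seq nat) : Prop :=
  is_Q K n P P.

Definition parts_differ_by_two (P : seq nat) : Prop :=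
  forall u : nat, (u.+1 < size P)%N -> (nth 0 P u.+1 + 2 <= nth 0 P u)%N.

(* Main.v *)
Require Import Defs.
From mathcomp Require Import all_boot all_order all_algebra.
From mathcomp Require Import mpoly.
From mathcomp Require Import zify.

Set Implicit Arguments.
Unset Strict Implicit.
Unset Printing Implicit Defensive.

Import GRing.Theory.
Local Open Scope ring_scope.

(** Read matrices as acting on row vectors, and index the standard basis by the
    boxes [(i, k)] of the Young diagram of [P]: block [i], offset [k < p_i], both
    counted from 0. The Jordan matrix [J] sends box [(i, k)] to box [(i, k + 1)],
    and [N_J] denotes the set of nilpotent matrices commuting with [J].

    Suppose that the parts differ by at least two. Give box [(i, k)] the height
    [i + k]. Commuting with [J] forces an element of [N_J] to raise the height
    strictly ([nilpotent_commutator_raises]): leaving a block for the next, shorter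
    one costs nothing in offset and gains one in block number, while going back
    loses one in block number and gains at least two in offset. Conversely any
    matrix that raises the height is nilpotent, so [N_J] contains, with each of
    its elements [A], the line through [A] and [J]. The open subset [U] of [N_J]
    is given by the non-vanishing of the determinant of the Krylov vectors
    [e i 0 *m A ^+ k], for all boxes [(i, k)]. This determinant is 1 at
    [A = J], so on each such line it is a nonzero polynomial in one variable, and
    [U] is dense because [K] is infinite ([zariski_dense_star]). For [A] in [U],
    the Krylov vectors of height at least [h] have the same span as the boxes of
    height at least [h], the span being preserved by the inverse of the Krylov
    matrix ([raises_invmx]). Applied to
    [e i 0 *m A ^+ p_i], of height at least [i + p_i], this gives a relation
    with the Krylov vectors of earlier blocks that is divisible by [A ^+ p_i];
    correcting [e i 0] by the quotient produces a generator killed by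
    [A ^+ p_i], and these generators form a Jordan basis of type [P]
    ([krylov_similar_jordan]).

    Suppose instead that [p_u - p_(u+1)] is 0 or 1. Then the two chains of [J] can
    be interleaved into one, [(u, k) -> (u+1, k) -> (u, k+1) -> ...], whose square
    is [J] on these two blocks. The resulting nilpotent matrix commutes with [J]
    and has larger rank ([merge_rank]). By lower semicontinuity of the rank, some
    nonempty open subset of [N_J] consists of matrices of rank larger than that of
    [J]. It contains no matrix similar to [J], so [P] is not stable. *)

(** * Matrices that raise a height *)

Section Height.

Variable K : fieldType.

(** The support condition of a filtered map of degree [d]: the basis vector [r] is
    sent into the span of the [s] with [h s >= g r + d]. A constant [g] on ['I_1]
    expresses that a row vector lies in a step of the filtration. *)
Definition raises (m n : nat) (g : 'I_m -> nat) (h : 'I_n -> nat) (d : nat)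
    (M : 'M[K]_(m, n)) : Prop :=
  forall r s, M r s != 0 -> (g r + d <= h s)%N.

Lemma mulmx_entry_neq0 (m n p : nat) (A : 'M[K]_(m, n)) (B : 'M[K]_(n, p)) r s :
  (A *m B) r s != 0 -> exists t, A r t != 0 /\ B t s != 0.
Proof.
rewrite mxE => nz.
have /existsP[t] : [exists t, A r t * B t s != 0].
  apply: contraR nz; rewrite negb_exists => /forallP z.
  by rewrite big1 // => t _; apply/eqP; rewrite -[_ == _]negbK; apply: z.
by rewrite mulf_eq0 negb_or => /andP[]; exists t.
Qed.

Lemma raisesM (m n p : nat) (f : 'I_m -> nat) (g : 'I_n -> nat)
    (h : 'I_p -> nat) (a b : nat) (M : 'M_(m, n)) (N : 'M_(n, p)) :
  raises f g a M -> raises g h b N -> raises f h (a + b) (M *m N).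
Proof.
move=> hM hN r s /mulmx_entry_neq0[t [/hM Mrt /hN Nts]].
by apply: leq_trans Nts; rewrite addnA leq_add2r.
Qed.

Lemma raisesX (n : nat) (h : 'I_n -> nat) (A : 'M[K]_n) (k : nat) :
  raises h h 1 A -> raises h h k (A ^+ k).
Proof.
move=> hA; elim: k => [|k IHk].
  move=> r s; rewrite expr0 mxE.
  by case: (r =P s) => [-> _|_]; rewrite ?addn0 // mulr0n eqxx.
by rewrite exprSr -addn1; apply: raisesM IHk hA.
Qed.

Lemma raises_nilpotent (n : nat) (h : 'I_n -> nat) (A : 'M[K]_n) :
  raises h h 1 A -> nilpotent_mx A.
Proof.
move=> hA; exists (\max_s h s).+1; apply/matrixP=> r s; rewrite [RHS]mxE.
apply/eqP; apply: contraT => /(raisesX hA).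
by rewrite leqNgt (leq_ltn_trans (leq_bigmax s)) // ltn_addl.
Qed.

(** The span of the basis vectors of height at least [t] is mapped into itself
    by [M], hence onto itself, as [M] preserves dimensions; so [M^-1] preserves
    it too. *)
Lemma raises_invmx (n : nat) (h : 'I_n -> nat) (M : 'M[K]_n) :
  M \in unitmx -> raises h h 0 M -> raises h h 0 (invmx M).
Proof.
move=> uM hM r s nz; rewrite addn0.
pose E := diag_mx (\row_j (h r <= h j)%N%:R) : 'M[K]_n.
have EM : E *m M = E *m M *m E.
  apply/matrixP=> i j; rewrite mul_mx_diag mul_diag_mx !mxE.
  have [z|/hM] := eqVneq (M i j) 0; first by rewrite z mulr0 mul0r.
  rewrite addn0 => hij; case: (leqP (h r) (h i)) => hri; last by rewrite !mul0r.
  by rewrite (leq_trans hri hij) mulr1.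
have rEM : \rank (E *m M) = \rank E by rewrite mxrankMfree // row_free_unit.
have /submxP[X XE] : (E <= E *m M)%MS.
  rewrite -(mxrank_leqif_sup (_ : E *m M <= E)%MS) ?rEM //.
  by rewrite EM submxMl.
have {XE} XE : E *m invmx M = X *m E.
  have := congr1 (fun Y => Y *m invmx M) XE.
  by rewrite EM !mulmxA => ->; rewrite -!mulmxA; congr (_ *m _);
     rewrite !mulmxA -EM mulmxK.
have := congr1 (fun Y : 'M_n => Y r s) XE.
rewrite mul_mx_diag mul_diag_mx !mxE leqnn mul1r.
by case: (leqP (h r) (h s)) => // _; rewrite mulr0 => z; rewrite z eqxx in nz.
Qed.

(** A triangular nilpotent matrix has a zero diagonal, since the diagonal of a
    power consists of the powers of the diagonal. *)
Lemma triangular_nilpotent_diag (n : nat) (h : 'I_n -> nat) (A : 'M[K]_n) :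
    (forall r s, A r s != 0 -> r = s \/ (h r < h s)%N) ->
  nilpotent_mx A -> forall r, A r r = 0.
Proof.
move=> hA [k Ak0] r.
suff [_ Ark] : (forall s, (A ^+ k) r s != 0 -> r = s \/ (h r < h s)%N)
    /\ (A ^+ k) r r = A r r ^+ k.
  by apply/eqP; move/eqP: Ark; rewrite Ak0 mxE eq_sym expf_eq0 => /andP[].
elim: k {Ak0} => [|k [IH1 IH2]].
  rewrite expr0; split=> [s|]; last by rewrite mxE eqxx.
  by rewrite mxE; case: (r =P s) => [-> _|_]; [left | rewrite mulr0n eqxx].
split=> [s|].
  rewrite exprSr => /mulmx_entry_neq0[t [/IH1 Akrt /hA Ats]].
  case: Akrt Ats => [<-|lt1] [<-|lt2]; [by left | by right | by right |].
  by right; apply: ltn_trans lt2.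
rewrite exprSr mxE (bigD1 r) //= IH2 big1 ?addr0 -?exprSr // => t ntr.
have [->|/IH1 [eq_rt|lt_rt]] := eqVneq ((A ^+ k) r t) 0; first by rewrite mul0r.
  by rewrite eq_rt eqxx in ntr.
have [->|/hA [eq_tr|lt_tr]] := eqVneq (A t r) 0; first by rewrite mulr0.
  by rewrite eq_tr eqxx in ntr.
by have := ltn_trans lt_rt lt_tr; rewrite ltnn.
Qed.

End Height.

(** * Polynomial functions of a matrix *)

Section Zariski.

Variables (K : fieldType) (n : nat).

Definition generic_mx : 'M[{mpoly K[n * n]}]_n :=
  \matrix_(i, j) 'X_(mxvec_index i j).

Lemma map_generic_mx (A : 'M[K]_n) :
  map_mx (meval (mxvec A 0)) generic_mx = A.
Proof. by apply/matrixP=> i j; rewrite !mxE mevalXU mxvecE. Qed.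

Lemma meval_line (N : nat) (p : {mpoly K[N]}) (u v : 'I_N -> K) :
  exists g : {poly K}, forall t, g.[t] = p.@[fun i => u i + t * v i].
Proof.
exists (\sum_(m <- msupp p)
          p@_m *: \prod_i ((u i)%:P + v i *: 'X) ^+ m i) => t.
rewrite mevalE horner_sum; apply: eq_bigr => m _.
rewrite hornerZ horner_prod; congr (_ * _); apply: eq_bigr => i _.
by rewrite horner_exp hornerD hornerC hornerZ hornerX mulrC.
Qed.

Lemma infinite_field_nonroot (g : {poly K}) :
  infinite_field K -> g != 0 -> exists t, g.[t] != 0.
Proof.
move=> hK g0.
have [s us ss] : exists2 s : seq K, uniq s & size s = size g.
  elim: (size g) => [|m [s us ss]]; first by exists [::].
  by have [x xs] := hK s; exists (x :: s); rewrite /= ?xs ?ss.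
have /allPn[t _ gt] : ~~ all (root g) s.
  by apply/negP => rs; have := max_poly_roots g0 rs us; rewrite ss ltnn.
by exists t.
Qed.

(** On a line through [B], the polynomial [q] and a polynomial that is nonzero
    somewhere on the line both become nonzero polynomials in one variable; over
    an infinite field their product does not vanish everywhere. *)
Lemma zariski_dense_star (V : 'M[K]_n -> Prop) (B : 'M[K]_n)
    (q : {mpoly K[n * n]}) :
    infinite_field K ->
    (forall A t, V A -> V (A + t *: (B - A))) ->
    q.@[mxvec B 0] != 0 ->
  zariski_dense_in V (fun A => V A /\ q.@[mxvec A 0] != 0).
Proof.
move=> hK starV qB W [S hW] [A /hW[VA [p Sp pA]]].
pose l t := A + t *: (B - A).
have lE t : mxvec (l t) 0 =1 fun i => mxvec A 0 i + t * mxvec (B - A) 0 i.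
  by move=> i; rewrite /l linearD linearZ !mxE.
have [g gE] := meval_line p (mxvec A 0) (mxvec (B - A) 0).
have [k kE] := meval_line q (mxvec A 0) (mxvec (B - A) 0).
have gl t : g.[t] = p.@[mxvec (l t) 0].
  by rewrite gE; apply: meval_eq => i; rewrite lE.
have kl t : k.[t] = q.@[mxvec (l t) 0].
  by rewrite kE; apply: meval_eq => i; rewrite lE.
have gk0 : g * k != 0.
  rewrite mulf_neq0 //.
    apply/eqP => g0; have := gl 0; rewrite g0 horner0 /l scale0r addr0 => p0.
    by rewrite -p0 eqxx in pA.
  apply/eqP => k0; have := kl 1; rewrite k0 horner0 /l scale1r addrC subrK => q0.
  by rewrite -q0 eqxx in qB.
have [t] := infinite_field_nonroot hK gk0.
rewrite hornerM mulf_eq0 negb_or gl kl => /andP[pl ql].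
by exists (l t); split; [apply/hW; split; [exact: starV | exists p]
  | split; first exact: starV].
Qed.

Lemma zariski_open_nonvanishing (V : 'M[K]_n -> Prop) (q : {mpoly K[n * n]}) :
  zariski_open_in V (fun A => V A /\ q.@[mxvec A 0] != 0).
Proof.
exists (eq q) => A; split=> [[VA qA]|[VA [_ <- qA]]]; last by [].
by split=> //; exists q.
Qed.

(** With [r = \rank A], some [C] and [D] give [C *m A *m D = 1] of size [r]. The
    polynomial [\det (C *m X *m D)] is then nonzero at [X = A], and where it does
    not vanish the rank of [X] is at least [r]. *)
Lemma rank_lower_semicontinuous (A : 'M[K]_n) :
  exists2 q : {mpoly K[n * n]}, q.@[mxvec A 0] != 0 &
    forall A' : 'M[K]_n, q.@[mxvec A' 0] != 0 -> (\rank A <= \rank A')%N.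
Proof.
have /submxP[C AC] : (row_base A <= A)%MS by rewrite eq_row_base.
have [D AD] := row_freeP (row_base_free A).
pose cst (m p : nat) := @map_mx K {mpoly K[n * n]} (@mpolyC (n * n) K) m p.
pose q := \det (cst _ _ C *m generic_mx *m cst _ _ D).
have cstE m p (X : 'M[K]_(m, p)) v : map_mx (meval v) (cst _ _ X) = X.
  by apply/matrixP=> i j; rewrite !mxE mevalC.
have qE A' : q.@[mxvec A' 0] = \det (C *m A' *m D).
  by rewrite -det_map_mx !map_mxM !cstE map_generic_mx.
exists q => [|A']; rewrite qE; first by rewrite -AC AD det1 oner_eq0.
rewrite -unitfE -unitmxE => uCAD.
apply: (@mulmx1_min_rank _ _ _ _ A' (invmx (C *m A' *m D) *m C) D).
by rewrite -(mulmxA _ C) -mulmxA mulVmx.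
Qed.

End Zariski.

(** * Basis vectors indexed by block and offset *)

Lemma natb_neq0 (R : nzRingType) (b : bool) : b%:R != 0 :> R -> b.
Proof. by case: b; rewrite // eqxx. Qed.

Section Blocks.

Variables (n : nat) (P : seq nat).
Hypothesis sumP : sumn P = n.

Local Notation blk := (reshape_index P).
Local Notation off := (reshape_offset P).
Local Notation part := (nth 0%N P).

Lemma off_lt (r : 'I_n) : (off r < part (blk r))%N.
Proof. by apply: reshape_offsetP; rewrite sumP. Qed.

Lemma blk_lt (r : 'I_n) : (blk r < size P)%N.
Proof. by apply: reshape_indexP; rewrite sumP. Qed.

Lemma index_ex (i k : nat) :
  (k < part i)%N -> exists r : 'I_n, blk r = i /\ off r = k.
Proof.
move=> ki; have lt_n : (flatten_index P i k < n)%N.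
  by rewrite -sumP flatten_indexP.
by exists (Ordinal lt_n); split; [apply: flatten_indexKl | apply: flatten_indexKr].
Qed.

Lemma index_inj (r s : 'I_n) : blk r = blk s -> off r = off s -> r = s.
Proof.
move=> eq_b eq_o; apply: val_inj.
by rewrite /= -(reshape_indexK P r) -(reshape_indexK P s) eq_b eq_o.
Qed.

(** The pair [(i, k)] ranges over all of nat * nat, with value zero outside the
    Young diagram of [P], so that shifts need no side conditions. *)
Definition bvec (R : nzRingType) (i k : nat) : 'rV[R]_n :=
  \row_s ((blk s == i) && (off s == k))%:R.

Lemma bvec_delta (R : nzRingType) (r : 'I_n) :
  bvec R (blk r) (off r) = delta_mx 0 r.
Proof.
apply/rowP=> s; rewrite !mxE eqxx /=; congr (_%:R); congr nat_of_bool.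
apply/andP/eqP => [[/eqP eb /eqP eo]|-> //]; exact: index_inj.
Qed.

Lemma bvec_out (R : nzRingType) (i k : nat) :
  (part i <= k)%N -> bvec R i k = 0.
Proof.
move=> ik; apply/rowP=> s; rewrite !mxE.
case: eqP => //= <- in ik *; case: eqP => // sk.
by have := off_lt s; rewrite sk ltnNge ik.
Qed.

Lemma map_bvec (R S : nzRingType) (f : {rmorphism R -> S}) (i k : nat) :
  map_mx f (bvec R i k) = bvec S i k.
Proof. by apply/rowP=> s; rewrite !mxE rmorph_nat. Qed.

Variable K : fieldType.
Local Notation e := (bvec K).
Local Notation J := (jordan_mx K n P).

Lemma bvec_dot (i k j l : nat) :
  e i k *m (e j l)^T = [&& i == j, k == l & (k < part i)%N]%:R%:M.
Proof.
case: (ltnP k (part i)) => [ki|ik]; last by rewrite bvec_out // mul0mx !andbF raddf0.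
have [r [<- <-]] := index_ex ki; rewrite bvec_delta -rowE.
by apply/matrixP=> a b; rewrite !ord1 !mxE andbT eqxx mulr1n.
Qed.

(** Boxes pushed out of the diagram are sent to zero, by the convention on
    [bvec]. This covers both [J] and the matrix that merges two of its chains. *)
Definition shift_mx (f d : nat -> nat) : 'M[K]_n :=
  \matrix_r e (f (blk r)) (off r + d (blk r)).

(** The hypothesis says that a box outside the diagram is never moved into it. *)
Lemma bvec_shift (f d : nat -> nat) (i k : nat) :
    (part (f i) <= part i + d i)%N ->
  e i k *m shift_mx f d = e (f i) (k + d i).
Proof.
move=> lefi; case: (ltnP k (part i)) => [ki|ik].
  by have [r [<- <-]] := index_ex ki; rewrite bvec_delta -rowE rowK.
by rewrite !bvec_out ?mul0mx // (leq_trans lefi) ?leq_add2r.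
Qed.

Lemma jordan_shift : J = shift_mx id (fun=> 1%N).
Proof.
apply/matrixP=> r s; rewrite !mxE; congr (_%:R); congr nat_of_bool.
rewrite andbC eq_sym; case: eqP => //= eq_b.
have rE := reshape_indexK P r; have sE := reshape_indexK P s.
by move: rE sE; rewrite /flatten_index eq_b; lia.
Qed.

Lemma bvec_jordan (i k m : nat) : e i k *m J ^+ m = e i (k + m).
Proof.
elim: m => [|m IHm]; first by rewrite expr0 mulmx1 addn0.
rewrite exprSr -mulmxE mulmxA IHm jordan_shift bvec_shift ?leq_addr //=.
by rewrite addn1 addnS.
Qed.

Lemma jordan_bvec_tr (j l m : nat) :
  J ^+ m *m (e j l)^T = if (m <= l < part j)%N then (e j (l - m))^T else 0.
Proof.
apply/row_matrixP=> r; rewrite row_mul rowE -bvec_delta bvec_jordan bvec_dot.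
case: ifP => ml; last first.
  rewrite row0; case: and3P => [[/eqP bj /eqP ol oj]|_]; last by rewrite raddf0.
  by move: ml oj; rewrite -ol -bj; lia.
rewrite rowE -bvec_delta bvec_dot; congr (_%:R%:M); congr nat_of_bool.
by have := off_lt r; case: eqP => //= eq_b; move: ml; rewrite -eq_b; lia.
Qed.

(** [A] maps the image of [J ^+ off r] and the kernel of
    [J ^+ (part (blk r) - off r)], both of which contain the basis vector of
    index [r], to themselves. *)
Lemma comm_jordan_support (A : 'M[K]_n) (r s : 'I_n) :
    comm_mx A J -> A r s != 0 ->
  (off r <= off s)%N /\ (off r + part (blk s) <= part (blk r) + off s)%N.
Proof.
move=> cAJ.
have cX m : A *m J ^+ m = J ^+ m *m A.
  have := @commrX _ A J m; rewrite /GRing.comm !mulmxE; apply.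
  by rewrite -mulmxE.
have ArsE : A r s = (e (blk r) (off r) *m A *m (e (blk s) (off s))^T) 0 0.
  by rewrite !bvec_delta -rowE mxE (bigD1 s) //= big1 ?addr0 => [|t nts];
     rewrite !mxE ?eqxx ?mulr1 // (negPf nts) mulr0.
move=> nz; split.
  rewrite leqNgt; apply: contra nz => lt_o; rewrite ArsE.
  rewrite -{1}[off r]add0n -bvec_jordan -!mulmxA (mulmxA _ A) -cX -!mulmxA.
  by rewrite jordan_bvec_tr leqNgt lt_o !mulmx0 mxE.
rewrite leqNgt; apply: contra nz => lt_p; rewrite ArsE.
pose m := (part (blk r) - off r)%N.
have ltm : (off s + m < part (blk s))%N.
  by have := off_lt r; rewrite /m; lia.
have := jordan_bvec_tr (blk s) (off s + m) m.
rewrite ltm leq_addl /= addnK => <-.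
rewrite mulmxA -(mulmxA _ A) cX mulmxA bvec_jordan bvec_out; last first.
  by rewrite /m; lia.
by rewrite !mul0mx mxE.
Qed.

(** Distinct boxes move to distinct boxes, so [shift_mx f d] times its transpose
    is the projection onto the boxes whose image stays in the diagram. *)
Lemma rank_shift_mx (f d : nat -> nat) :
    injective f ->
  \rank (shift_mx f d) =
    #|[set r : 'I_n | (off r + d (blk r) < part (f (blk r)))%N]|.
Proof.
move=> injf; set D := [set r | _]; set A := shift_mx f d.
pose E (S : {set 'I_n}) := \sum_(r in S) delta_mx r r : 'M[K]_n.
have rkE S : (\rank (E S) <= #|S|)%N.
  rewrite -sum1_card /E; elim/big_rec2: _ => [|r k X _ IH]; first by rewrite mxrank0.
  by apply: leq_trans (mxrank_add _ _) _; rewrite mxrank_delta leq_add2l.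
have EE S : E S = diag_mx (\row_r (r \in S)%:R).
  rewrite diag_mx_sum_delta /E big_mkcond; apply: eq_bigr => r _.
  by rewrite mxE; case: (r \in S); rewrite ?scale1r ?scale0r.
have EC : E D + E (~: D) = 1%:M.
  apply/matrixP=> r s; rewrite !EE !mxE in_setC.
  by case: (r == s); case: (r \in D); rewrite ?mulr1n ?mulr0n ?addr0 ?add0r.
have EDA : E D *m A = A.
  apply/row_matrixP=> r; rewrite EE mul_diag_mx rowK.
  apply/rowP=> s; rewrite !mxE inE; case: ltnP => [_|le]; first by rewrite mul1r.
  rewrite mul0r; case: eqP => //= eq_f; case: eqP => // eq_o.
  by have := off_lt s; rewrite eq_f eq_o ltnNge le.
have AAT : A *m A^T = E D.
  apply/matrixP=> r s; have -> : (A *m A^T) r s = (row r A *m (row s A)^T) 0 0.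
    by rewrite !mxE; apply: eq_bigr => t _; rewrite !mxE.
  rewrite !rowK bvec_dot EE !mxE mulr1n inE.
  case: (r =P s) => [->|nrs]; first by rewrite !eqxx /= mulr1n.
  case: and3P => // -[/eqP/injf eq_b /eqP]; rewrite eq_b => /addIn eq_o _.
  by case: nrs; apply: index_inj.
apply/eqP; rewrite eqn_leq; apply/andP; split.
  by rewrite -EDA (leq_trans (mxrankM_maxl _ _)).
apply: leq_trans (mxrankM_maxl A A^T); rewrite AAT.
have : (n <= \rank (E D) + #|~: D|)%N.
  rewrite -{1}(mxrank1 K n) -EC (leq_trans (mxrank_add _ _)) //.
  by rewrite leq_add2l rkE.
by have := cardsC D; rewrite card_ord; lia.
Qed.

(** * Parts that differ by at least two: the normal form of a generic element *)

Definition height (r : 'I_n) : nat := blk r + off r.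

Definition krylov_mx (A : 'M[K]_n) : 'M[K]_n :=
  \matrix_r (e (blk r) 0 *m A ^+ off r).

Lemma krylov_mx_jordan : krylov_mx J = 1%:M.
Proof.
apply/row_matrixP=> r.
by rewrite rowK bvec_jordan add0n bvec_delta rowE mulmx1.
Qed.

Lemma krylov_det_polynomial :
  exists q : {mpoly K[n * n]},
    forall A : 'M[K]_n, q.@[mxvec A 0] = \det (krylov_mx A).
Proof.
exists (\det (\matrix_r (bvec _ (blk r) 0 *m generic_mx K n ^+ off r))) => A.
rewrite -det_map_mx; congr (\det _); apply/row_matrixP=> r.
by rewrite -map_row !rowK map_mxM map_bvec rmorphXn /= map_generic_mx.
Qed.

Lemma jordan_raises : raises height height 1 J.
Proof.
move=> r s; rewrite jordan_shift !mxE /height /= => /natb_neq0.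
by case/andP=> /eqP-> /eqP->; rewrite addnA.
Qed.

Lemma jordan_in_commutator : nilpotent_commutator J J.
Proof. by split; first exact: raises_nilpotent jordan_raises. Qed.

Hypothesis gap : parts_differ_by_two P.

Lemma part_gap (i j : nat) :
  (i <= j < size P)%N -> (part j + 2 * (j - i) <= part i)%N.
Proof.
case/andP=> le_ij; rewrite -(subnKC le_ij) addKn.
elim: (j - i)%N => [|d IH] lt_s; first by rewrite addn0; lia.
by rewrite addnS in lt_s *; have := gap lt_s; have := IH (ltnW lt_s); lia.
Qed.

(** Commutation with [J] bounds the entries of [A]: passing from block [i] to a
    shorter block [j] cannot lower the offset, and passing to a longer one adds
    at least [part j - part i >= 2 * (i - j)] to it, so that the height strictly
    increases in both cases. Inside a block the offset cannot decrease, and the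
    entries that keep it are on the diagonal, hence zero by nilpotency. *)
Lemma nilpotent_commutator_raises (A : 'M[K]_n) :
  nilpotent_commutator J A -> raises height height 1 A.
Proof.
case=> nilA cAJ.
have tri r s : A r s != 0 -> r = s \/ (height r < height s)%N.
  move=> /(comm_jordan_support cAJ)[le_o le_p].
  have := blk_lt r; have := blk_lt s; rewrite /height => lt_s lt_r.
  case: (ltngtP (blk r) (blk s)) => [lt|gt|eq_b].
  - by right; lia.
  - have := @part_gap (blk s) (blk r).
    by rewrite (ltnW gt) lt_r => /(_ isT); right; lia.
  case: (eqVneq (off r) (off s)) => [eq_o|]; first by left; apply: index_inj.
  by right; lia.
have diag := triangular_nilpotent_diag tri nilA.
move=> r s nz; rewrite addn1; case: (tri r s nz) => // eq_rs.
by rewrite eq_rs diag eqxx in nz.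
Qed.

Lemma bvec_raises (i k : nat) :
  raises (fun _ : 'I_1 => (i + k)%N) height 0 (e i k).
Proof.
move=> z s; rewrite !mxE addn0 /height => /natb_neq0.
by case/andP=> /eqP-> /eqP->.
Qed.

(** Since [A] raises heights by one, [e i 0 *m A ^+ part i] lies in the span
    of the boxes of height at least [i + part i]. When the Krylov rows form a
    basis, those of height at least [i + part i] span the same space, and
    strictly decreasing [j + part j] makes them belong to blocks [j < i] and have
    exponents at least [part i]. Factoring [A ^+ part i] out of the resulting
    relation corrects [e i 0] to a vector killed by [A ^+ part i], and the
    corrected chains form a Jordan basis of type [P]. *)
Lemma krylov_similar_jordan (A : 'M[K]_n) :
    raises height height 1 A -> krylov_mx A \in unitmx ->
  similar_in unitmx A J.
Proof.
move=> hA; set M := krylov_mx A => uM.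
have hM : raises height height 0 M.
  move=> r s; rewrite addn0 => nz.
  have /(_ 0 s) := raisesM (@bvec_raises (blk r) 0) (raisesX (k := off r) hA).
  rewrite !addn0 add0n /height; apply.
  by move: nz; rewrite [M r s]mxE.
pose z i := e i 0 *m A ^+ part i *m invmx M.
have z_supp i s : (i < size P)%N -> z i 0 s != 0 ->
    (blk s < i)%N /\ (part i <= off s)%N.
  move=> lt_i nz.
  have := raisesM (raisesM (@bvec_raises i 0) (raisesX (k := part i) hA))
    (raises_invmx uM hM) nz.
  rewrite /height; have := off_lt s; have := blk_lt s.
  have := @part_gap i (blk s); have := @part_gap (blk s) i; lia.
pose w i := e i 0 - \sum_s z i 0 s *: (e (blk s) 0 *m A ^+ (off s - part i)).
have w_kill i : (i < size P)%N -> w i *m A ^+ part i = 0.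
  move=> lt_i; rewrite /w mulmxBl mulmx_suml.
  rewrite -[X in X - _](mulmxKV uM) -/(z i) mulmx_sum_row -sumrB big1 // => s _.
  rewrite rowK -scalemxAl -mulmxA mulmxE -exprD -scalerBr.
  have [->|/(z_supp _ _ lt_i)[_ le_o]] := eqVneq (z i 0 s) 0.
    by rewrite scale0r.
  by rewrite subnK // subrr scaler0.
pose N : 'M_n := \matrix_r (w (blk r) *m A ^+ off r).
have rowN i k : (i < size P)%N -> (k <= part i)%N ->
    e i k *m N = w i *m A ^+ k.
  move=> lt_i; rewrite leq_eqVlt => /orP[/eqP->|lt_k].
    by rewrite bvec_out // mul0mx w_kill.
  by have [r [<- <-]] := index_ex lt_k; rewrite bvec_delta -rowE rowK.
have NA : N *m A = J *m N.
  apply/row_matrixP=> r; rewrite !row_mul rowK jordan_shift rowK /= addn1.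
  by rewrite rowN ?blk_lt ?off_lt // exprSr -mulmxA.
have stableN m (X : 'M_(m, n)) k : (X <= N)%MS -> (X *m A ^+ k <= N)%MS.
  move=> XN; elim: k => [|k IHk]; first by rewrite expr0 mulmx1.
  rewrite exprSr -mulmxE mulmxA (submx_trans (submxMr A IHk)) //.
  by rewrite NA submxMl.
(* Strong induction on [i]: the correction only involves blocks before [i]. *)
have eN i : (i < size P)%N -> (e i 0 <= N)%MS.
  elim/ltn_ind: i => i IHi lt_i.
  rewrite -(subrK (\sum_s z i 0 s *: (e (blk s) 0 *m A ^+ (off s - part i)))
                  (e i 0)).
  apply: addmx_sub.
    by rewrite -[X in (X <= _)%MS]mulmx1 -[1%:M](expr0 A) -rowN // submxMl.
  apply: summx_sub => s _.
  have [->|/(z_supp _ _ lt_i)[lt_s _]] := eqVneq (z i 0 s) 0.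
    by rewrite scale0r sub0mx.
  by rewrite scalemx_sub // stableN // IHi // blk_lt.
have uN : N \in unitmx.
  rewrite -row_full_unit -sub1mx -(mulVmx uM).
  apply: submx_trans (submxMl _ _) _; apply/row_subP=> r.
  by rewrite rowK stableN // eN // blk_lt.
by exists N => //; apply/similarP.
Qed.

End Blocks.

Theorem stable_of_gap (K : fieldType) (n : nat) (P : seq nat) :
    infinite_field K -> is_partition n P -> parts_differ_by_two P ->
  stable K n P.
Proof.
move=> hK hP gap; have /and3P[_ _ /eqP sumP] := hP.
have [q qE] := @krylov_det_polynomial n P K.
have JC := jordan_in_commutator sumP K.
exists (fun A => nilpotent_commutator (jordan_mx K n P) A
               /\ q.@[mxvec A 0] != 0); split.
- exact: zariski_open_nonvanishing.
- apply: zariski_dense_star (jordan_mx K n P) _ hK _ _.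
    move=> A t VA.
    have hA := nilpotent_commutator_raises sumP gap VA.
    split.
      apply: (@raises_nilpotent _ _ (@height n P)) => r s.
      rewrite !mxE => nz.
      have [A0|/hA //] := eqVneq (A r s) 0.
      have [J0|/(jordan_raises sumP) //] := eqVneq (jordan_mx K n P r s) 0.
      by move: nz J0; rewrite A0 !mxE => /[swap] ->; rewrite subr0 mulr0 addr0 eqxx.
    have [_ cA] := VA.
    by rewrite /comm_mx mulmxDl mulmxDr -scalemxAl -scalemxAr mulmxBl mulmxBr cA.
  by rewrite qE krylov_mx_jordan // det1 oner_eq0.
move=> A [VA]; rewrite qE -unitfE -unitmxE => uA; split=> //.
apply: krylov_similar_jordan => //.
exact: nilpotent_commutator_raises VA.
Qed.

(** * Parts that differ by at most one: a commuting nilpotent of larger rank *)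

Section Merge.

Variables (K : fieldType) (n : nat) (P : seq nat) (u : nat).
Hypothesis sumP : sumn P = n.
Local Notation part := (nth 0%N P).
Hypothesis part_desc : (part u.+1 <= part u)%N.
Hypothesis part_close : (part u <= (part u.+1).+1)%N.
Hypothesis part_pos : (0 < part u.+1)%N.

Definition swap_blocks (i : nat) : nat :=
  if i == u then u.+1 else if i == u.+1 then u else i.

(** Moving from [u] to [u.+1] keeps the offset; moving back increases it by one,
    as does the ordinary step inside each of the remaining blocks. *)
Definition merge_mx : 'M[K]_n :=
  shift_mx n P K swap_blocks (fun i => (i != u)%N).

Local Notation J := (jordan_mx K n P).

Lemma swap_blocksK : involutive swap_blocks.
Proof.
move=> i; rewrite /swap_blocks.
case: (i =P u) => [->|iu]; first by rewrite eqxx (gtn_eqF (ltnSn u)).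
by case: (i =P u.+1) => [->|iv]; [rewrite eqxx | case: eqP => //; case: eqP].
Qed.

Lemma merge_fits (i : nat) : (part (swap_blocks i) <= part i + (i != u))%N.
Proof.
rewrite /swap_blocks; case: eqP => [->|_]; first by rewrite addn0.
by case: eqP => [->|_]; lia.
Qed.

Lemma merge_comm : comm_mx merge_mx J.
Proof.
apply/row_matrixP=> r; rewrite !rowE -(bvec_delta P K) !mulmxA.
rewrite /merge_mx bvec_shift ?merge_fits // -[J]expr1 !bvec_jordan //.
by rewrite bvec_shift ?merge_fits // addnAC.
Qed.

(** The height below numbers the boxes along the merged chain, where those of
    blocks [u] and [u.+1] alternate; doubling the offset makes room for this. *)
Lemma merge_nilpotent : nilpotent_mx merge_mx.
Proof.
apply: (@raises_nilpotent _ _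
  (fun r => 2 * reshape_offset P r + (reshape_index P r == u.+1))%N) => r s.
rewrite !mxE => /natb_neq0/andP[/eqP-> /eqP->].
rewrite /swap_blocks; case: (_ =P u) => [->|_]; first by rewrite eqxx; lia.
by case: (_ =P u.+1) => [_|nv]; lia.
Qed.

(** Ends of blocks other than [u] and [u.+1] have no successor in either matrix,
    and the merged chain has one end instead of two. *)
Lemma merge_rank : (\rank J < \rank merge_mx)%N.
Proof.
rewrite jordan_shift // !rank_shift_mx //; last exact: can_inj swap_blocksK.
apply: proper_card; apply/properP; split.
  apply/subsetP=> r; rewrite !inE /swap_blocks /=.
  by case: eqP => [->|_]; [lia|case: eqP => [->|_]; lia].
(* The chain of block [u] or that of [u.+1] now continues past its last box:
   the former if the two lengths agree, the latter if they do not. *)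
case: (eqVneq (part u) (part u.+1)) => [eq_p|ne_p].
  have [|r [br or]] := @index_ex n P sumP u (part u).-1; first by lia.
  by exists r; rewrite !inE br or /swap_blocks ?eqxx /=; lia.
have [|r [br or]] := @index_ex n P sumP u.+1 (part u.+1).-1.
  by rewrite ltn_predL.
by exists r; rewrite !inE br or /swap_blocks ?(gtn_eqF (ltnSn u)) ?eqxx /=; lia.
Qed.

End Merge.

Theorem gap_of_stable (K : fieldType) (n : nat) (P : seq nat) :
  is_partition n P -> stable K n P -> parts_differ_by_two P.
Proof.
move=> /and3P[sP P1 /eqP sumP] [U [_ denseU typeU]] u lt_u.
rewrite leqNgt; apply/negP => close.
have desc : (nth 0 P u.+1 <= nth 0 P u)%N by move/(sortedP 0%N): sP; apply.
have pos : (0 < nth 0 P u.+1)%N by apply: (allP P1); apply: mem_nth.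
have rk := @merge_rank K n P u sumP desc _ pos.
have {}rk : (\rank (jordan_mx K n P) < \rank (merge_mx K n P u))%N.
  by apply: rk; lia.
have [q qA qle] := rank_lower_semicontinuous (merge_mx K n P u).
have [|A [[VA qA'] UA]] := denseU _ (zariski_open_nonvanishing
  (nilpotent_commutator (jordan_mx K n P)) q).
  exists (merge_mx K n P u); split=> //; split; first by apply: merge_nilpotent; lia.
  by apply: merge_comm => //; lia.
have [_ [N uN /(similarRL uN) JE]] := typeU A UA.
move: rk; rewrite ltnNge JE => /negP[]; apply: leq_trans (qle A qA') _.
by rewrite mxrankMfree ?row_free_unit ?unitmx_inv // eqmxMfull // row_full_unit.
Qed.

Theorem theorem1 (K : fieldType) (n : nat) (P : seq nat)
    (hK : infinite_field K) (hn : (0 < n)%N) (hP : is_partition n P) :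
  stable K n P <-> parts_differ_by_two P.
Proof. by split; [exact: gap_of_stable | exact: stable_of_gap]. Qed.
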